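(* Let $h$ be an order function and let $X\subseteq\omega$ be an oracle that computes no $\mathrm{DNC}_h$ function. Then there is a function $f$ that is DNC relative to $X$ such that $f\oplus X$ computes no $\mathrm{DNC}_h$ function.
   Context: An order function is a computable, nondecreasing, unbounded function $h:\omega\to\omega$. Let $(\varphi_e)$ and $(\varphi^X_e)$ be standard enumerations of the partial computable functions and of the partial $X$-computable functions. A function $f:\omega\to\omega$ is DNC if $f(e)\ne\varphi_e(e)$ whenever $\varphi_e(e)$ converges, and DNC relative to $X$ if $f(e)\neq\varphi^X_e(e)$ whenever $\varphi^X_e(e)$ converges. $\mathrm{DNC}_h$ denotes the set of DNC functions $f$ (unrelativized) with $f(e)<h(e)$ for all $e$. *)

(* Defs.v *)
From Stdlib Require Import Arith Cantor ClassicalEpsilon.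

Definition pr (a b : nat) : nat := Cantor.to_nat (a, b).
Arguments pr : simpl never.

(** Programs for the unary partial functions on [nat] computable from an oracle
    [nat -> nat]: the usual mu-recursive schemes, with functions of several
    arguments made unary by means of Cantor's pairing bijection [pr]. *)
Inductive code : Type :=
| Zero
| Succ
| Fst
| Snd
| Oracle
| Pair (c d : code)
| Comp (c d : code)
| Prec (c d : code)
| Mu (c : code).

(** [eval O c n m]: the program [c] with oracle [O] halts on input [n] with
    output [m]. In [eval_Mu], [v] lists the nonzero values, minus one, met
    before the least zero is reached; all of these must be defined. *)
Inductive eval (O : nat -> nat) : code -> nat -> nat -> Prop :=
| eval_Zero n : eval O Zero n 0
| eval_Succ n : eval O Succ n (S n)
| eval_Fst a b : eval O Fst (pr a b) a
| eval_Snd a b : eval O Snd (pr a b) b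
| eval_Oracle n : eval O Oracle n (O n)
| eval_Pair c d n a b :
    eval O c n a -> eval O d n b -> eval O (Pair c d) n (pr a b)
| eval_Comp c d n k m :
    eval O d n k -> eval O c k m -> eval O (Comp c d) n m
| eval_Prec0 c d a m :
    eval O c a m -> eval O (Prec c d) (pr a 0) m
| eval_PrecS c d a k r m :
    eval O (Prec c d) (pr a k) r ->
    eval O d (pr a (pr k r)) m ->
    eval O (Prec c d) (pr a (S k)) m
| eval_Mu c a k (v : nat -> nat) :
    (forall j, j < k -> eval O c (pr a j) (S (v j))) ->
    eval O c (pr a k) 0 ->
    eval O (Mu c) a k.

Fixpoint goedel (c : code) : nat :=
  match c with
  | Zero => pr 0 0
  | Succ => pr 1 0
  | Fst => pr 2 0
  | Snd => pr 3 0
  | Oracle => pr 4 0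
  | Pair c d => pr 5 (pr (goedel c) (goedel d))
  | Comp c d => pr 6 (pr (goedel c) (goedel d))
  | Prec c d => pr 7 (pr (goedel c) (goedel d))
  | Mu c => pr 8 (goedel c)
  end.

Lemma pr_inj a b a' b' : pr a b = pr a' b' -> a = a' /\ b = b'.
Proof. unfold pr; intros H; apply Cantor.to_nat_inj in H; now injection H. Qed.

Lemma goedel_inj c c' : goedel c = goedel c' -> c = c'.
Proof.
  revert c'; induction c; intros [] H; cbn [goedel] in H;
    apply pr_inj in H as [H0 H]; try discriminate H0; try reflexivity;
    try (apply pr_inj in H as [H1 H2]); f_equal; auto.
Qed.

Lemma eval_det O c n m m' : eval O c n m -> eval O c n m' -> m = m'.
Proof.
  intros H; revert m'; induction H; intros m' H';
    match type of H' with eval _ _ ?x _ =>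
      let y := fresh in remember x as y eqn:Hy in H' end;
    inversion H'; subst;
    repeat match goal with
    | E : pr _ _ = pr _ _ |- _ => apply pr_inj in E as [? E]; subst
    | E : S _ = S _ |- _ => injection E as E; subst
    end; try discriminate; auto.
  - match goal with E : eval O d n ?x |- _ =>
      rewrite <- (IHeval1 _ E) in * end; auto.
  - match goal with E : eval O (Prec c d) (pr _ k) ?x |- _ =>
      rewrite <- (IHeval1 _ E) in * end; auto.
  - destruct (Nat.lt_trichotomy k m') as [L | [L | L]]; auto; exfalso.
    + match goal with E : forall j, j < m' -> _ |- _ =>
        specialize (IHeval _ (E _ L)) end; discriminate.
    + match goal with E : eval O c (pr a m') 0 |- _ =>
        specialize (H0 _ L _ E) end; discriminate.
Qed.

(** [phi O e n m]: the [e]-th partial [O]-computable function converges on [n]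
    with value [m]. A number which is not the Goedel number of a program is an
    index of the nowhere defined function. *)
Definition phi (O : nat -> nat) (e n m : nat) : Prop :=
  exists c, goedel c = e /\ eval O c n m.

(** The unrelativized enumeration is the one with the empty oracle, whose
    characteristic function is constantly 0. *)
Definition phi0 : nat -> nat -> nat -> Prop := phi (fun _ => 0).

Definition computes (O g : nat -> nat) : Prop :=
  exists e, forall n, phi O e n (g n).

Definition computable (g : nat -> nat) : Prop :=
  exists e, forall n, phi0 e n (g n).

Definition char (X : nat -> Prop) (n : nat) : nat :=
  if excluded_middle_informative (X n) then 1 else 0.

Definition join (f g : nat -> nat) (n : nat) : nat :=
  if Nat.even n then f (Nat.div2 n) else g (Nat.div2 n).

Definition order_function (h : nat -> nat) : Prop :=
  computable h /\
  (forall m n, m <= n -> h m <= h n) /\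
  (forall b, exists n, b < h n).

Definition DNC (f : nat -> nat) : Prop :=
  forall e m, phi0 e e m -> f e <> m.

Definition DNC_rel (X : nat -> Prop) (f : nat -> nat) : Prop :=
  forall e m, phi (char X) e e m -> f e <> m.

Definition DNC_below (h f : nat -> nat) : Prop :=
  DNC f /\ forall e, f e < h e.

(* Main.v *)
(** Forcing with bushy trees. A set of strings is [k]-big above [t] if it contains
    the leaves of a finite tree above [t] in which every other node has at least
    [k] children. A condition is a string together with a set, not [k]-big above
    it for some [k], of strings to be avoided; the strings that are not DNC
    relative to [X] form a set not 2-big above the empty string.

    Given a functional [c], let [A x v] be the set of strings [u] such that [c]
    maps [x] to [v] with oracle [u] joined with [X]. If for some [x] the union of
    the [A x v] with [v < h x] is not [M]-big for some [M], then this union can be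
    avoided from now on. Otherwise, by pigeonhole, for each [x] some [A x v] with
    [v < h x] is [k]-big, and [X] finds such a [v] effectively because bigness of
    a semidecidable set is semidecidable. The resulting function is bounded by
    [h] and computed by [X], hence not DNC: its value at some [e] is the output
    of [phi0 e] on [e]. As [A e v] is [k]-big for this value [v], the string can
    be extended into it while the avoided set stays not [k]-big. *)

From Stdlib Require Import Arith Lia List Cantor Classical ClassicalEpsilon.
Require Import Defs.

(** * Projections of the pairing function *)

Definition p1 (n : nat) : nat := fst (Cantor.of_nat n).
Definition p2 (n : nat) : nat := snd (Cantor.of_nat n).

Lemma p1_pr a b : p1 (pr a b) = a.
Proof. unfold p1, pr; now rewrite Cantor.cancel_of_to. Qed.

Lemma p2_pr a b : p2 (pr a b) = b.
Proof. unfold p2, pr; now rewrite Cantor.cancel_of_to. Qed.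

Lemma pr_eta n : pr (p1 n) (p2 n) = n.
Proof.
  unfold pr, p1, p2; rewrite <- surjective_pairing; apply Cantor.cancel_to_of.
Qed.

(** ** Recursive functions *)

Definition rec (O f : nat -> nat) : Prop := exists c, forall n, eval O c n (f n).

Lemma rec_ext O f g : (forall n, f n = g n) -> rec O f -> rec O g.
Proof. intros E [c H]; exists c; intros n; rewrite <- E; apply H. Qed.

Lemma eval_fst O n : eval O Fst n (p1 n).
Proof. rewrite <- (pr_eta n) at 1; constructor. Qed.

Lemma eval_snd O n : eval O Snd n (p2 n).
Proof. rewrite <- (pr_eta n) at 1; constructor. Qed.

Lemma rec_comp O f g : rec O f -> rec O g -> rec O (fun n => f (g n)).
Proof. intros [c Hc] [d Hd]; exists (Comp c d); intros n; econstructor; eauto. Qed.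

Lemma rec_id O : rec O (fun n => n).
Proof.
  exists (Pair Fst Snd); intros n; rewrite <- (pr_eta n) at 2.
  constructor; [apply eval_fst | apply eval_snd].
Qed.

Lemma rec_S O f : rec O f -> rec O (fun n => S (f n)).
Proof. apply rec_comp; exists Succ; constructor. Qed.

Lemma rec_const O k : rec O (fun _ => k).
Proof. induction k; [exists Zero; constructor | now apply rec_S]. Qed.

Lemma rec_p1 O f : rec O f -> rec O (fun n => p1 (f n)).
Proof. apply rec_comp; exists Fst; apply eval_fst. Qed.

Lemma rec_p2 O f : rec O f -> rec O (fun n => p2 (f n)).
Proof. apply rec_comp; exists Snd; apply eval_snd. Qed.

Lemma rec_pr O f g : rec O f -> rec O g -> rec O (fun n => pr (f n) (g n)).
Proof. intros [c Hc] [d Hd]; exists (Pair c d); constructor; auto. Qed.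

Lemma rec_oracle O : rec O O.
Proof. exists Oracle; constructor. Qed.

Definition natrec (a : nat) (g : nat -> nat -> nat) (n : nat) : nat :=
  nat_rect (fun _ => nat) a g n.

Lemma rec_natrec O f G b :
  rec O f -> rec O (fun p => G (p1 p) (p1 (p2 p)) (p2 (p2 p))) -> rec O b ->
  rec O (fun n => natrec (f n) (G n) (b n)).
Proof.
  intros [cf Hf] [cG HG] Hb.
  (* [Prec] keeps the first component of its input as a parameter and recurses on the second;
     [pr n (b n)] is substituted afterwards. *)
  assert (H : rec O (fun p => natrec (f (p1 p)) (G (p1 p)) (p2 p))).
  { exists (Prec cf cG); intros p; rewrite <- (pr_eta p) at 1.
    induction (p2 p) as [|k IH]; econstructor; eauto.
    specialize (HG (pr (p1 p) (pr k (natrec (f (p1 p)) (G (p1 p)) k)))).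
    now rewrite !p2_pr, !p1_pr in HG. }
  eapply rec_ext; [| exact (rec_comp _ _ _ H (rec_pr _ _ _ (rec_id O) Hb))].
  intros n; cbn beta; now rewrite p1_pr, p2_pr.
Qed.

Definition ifz (a b c : nat) : nat := natrec b (fun _ _ => c) a.

(** The string [t] prolonged by the entry [i], in the coding that [ent] decodes. *)
Definition child (t i : nat) : nat := pr (S (p1 t)) (pr i (p2 t)).
(** Lists are coded by iterated pairing without their length, so every number can be read at every
    position. *)
Definition nthc (W j : nat) : nat := p1 (Nat.iter j p2 W).

Ltac rec_step :=
  match goal with
  | H : rec ?O ?f |- rec ?O ?f => exact H
  | |- rec ?O p1 => apply (rec_p1 O (fun n => n))
  | |- rec ?O p2 => apply (rec_p2 O (fun n => n))
  | |- rec _ (fun n => n) => apply rec_id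
  | |- rec _ (fun _ => ?k) => apply rec_const
  | |- rec _ (fun n => S (@?a n)) => apply (rec_S _ a)
  | |- rec _ (fun n => p1 (@?a n)) => apply (rec_p1 _ a)
  | |- rec _ (fun n => p2 (@?a n)) => apply (rec_p2 _ a)
  | |- rec _ (fun n => pr (@?a n) (@?b n)) => apply (rec_pr _ a b)
  | |- rec ?O (fun n => ?O (@?a n)) => apply (rec_comp _ O a (rec_oracle O))
  | H : rec ?O ?f |- rec ?O (fun n => ?f (@?a n)) => apply (rec_comp _ f a H)
  | |- rec _ (fun n => natrec (@?a n) (@?g n) (@?b n)) => apply (rec_natrec _ a g b)
  | |- rec _ (fun n => ifz (@?a n) (@?b n) (@?c n)) =>
      apply (rec_natrec _ b (fun n _ _ => c n) a)
  | |- rec _ (fun n => child (@?a n) (@?b n)) => unfold child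
  end; cbv beta.
Ltac recs := cbv beta; repeat rec_step.

Lemma rec_pred O f : rec O f -> rec O (fun n => pred (f n)).
Proof.
  intros H; apply (rec_ext _ (fun n => natrec 0 (fun k _ => k) (f n))); [|recs].
  intros n; now destruct (f n).
Qed.

Lemma rec_sub O f g : rec O f -> rec O g -> rec O (fun n => f n - g n).
Proof.
  intros Hf Hg.
  apply (rec_ext _ (fun n => natrec (f n) (fun _ r => pred r) (g n))).
  - intros n; induction (g n) as [|k IH]; [cbn; lia |].
    change (pred (natrec (f n) (fun _ r => pred r) k) = f n - S k); lia.
  - recs; apply rec_pred; recs.
Qed.

Lemma rec_double O f : rec O f -> rec O (fun n => 2 * f n).
Proof.
  intros Hf; apply (rec_ext _ (fun n => natrec 0 (fun _ r => S (S r)) (f n))); [|recs].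
  intros n; induction (f n) as [|k IH]; [reflexivity |].
  change (S (S (natrec 0 (fun _ r => S (S r)) k)) = 2 * S k); lia.
Qed.

Lemma rec_nthc O f g : rec O f -> rec O g -> rec O (fun n => nthc (f n) (g n)).
Proof.
  intros Hf Hg; unfold nthc, Nat.iter; apply rec_p1.
  apply (rec_natrec _ f (fun _ _ r => p2 r) g); recs.
Qed.

Ltac rec_step2 :=
  match goal with
  | |- rec _ (fun n => 2 * @?a n) => apply (rec_double _ a)
  | |- rec _ (fun n => @?a n - @?b n) => apply (rec_sub _ a b)
  | |- rec _ (fun n => nthc (@?a n) (@?b n)) => apply (rec_nthc _ a b)
  end; cbv beta.
Ltac recs ::= cbv beta; repeat first [rec_step | rec_step2].

Fixpoint pack (w : nat -> nat) (k : nat) : nat :=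
  match k with
  | 0 => 0
  | S k => pr (w 0) (pack (fun j => w (S j)) k)
  end.

Lemma nthc_0 a W : nthc (pr a W) 0 = a.
Proof. apply p1_pr. Qed.

Lemma nthc_S a W j : nthc (pr a W) (S j) = nthc W j.
Proof. unfold nthc; now rewrite Nat.iter_succ_r, p2_pr. Qed.

Lemma nthc_pack k : forall w j, j < k -> nthc (pack w k) j = w j.
Proof.
  induction k as [|k IH]; intros w [|j] L; cbn [pack]; try lia.
  - apply nthc_0.
  - rewrite nthc_S; apply (IH (fun j => w (S j))); lia.
Qed.

Lemma bounded_choice (R : nat -> nat -> Prop) k :
  (forall j, j < k -> exists w, R j w) ->
  exists w : nat -> nat, forall j, j < k -> R j (w j).
Proof.
  intros H; exists (fun j => epsilon (inhabits 0) (R j)); intros j L.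
  apply epsilon_spec; auto.
Qed.

(** ** Decidable and semidecidable predicates *)

(** Truth is coded by 0, the value for which [Mu] searches. *)
Definition dec (O : nat -> nat) (Q : nat -> Prop) : Prop :=
  exists f, rec O f /\ forall n, Q n <-> f n = 0.

Lemma dec_ext O (Q R : nat -> Prop) : (forall n, Q n <-> R n) -> dec O Q -> dec O R.
Proof.
  intros E (f & Hf & H); exists f; split; [easy|]; intros n.
  now rewrite <- E.
Qed.

Lemma dec_sub O Q f : dec O Q -> rec O f -> dec O (fun n => Q (f n)).
Proof.
  intros (q & Hq & H) Hf; exists (fun n => q (f n)); split; [recs | auto].
Qed.

Lemma dec_lt O f g : rec O f -> rec O g -> dec O (fun n => f n < g n).
Proof.
  intros Hf Hg; exists (fun n => S (f n) - g n); split; [recs | intros; lia].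
Qed.

Lemma dec_and O Q R : dec O Q -> dec O R -> dec O (fun n => Q n /\ R n).
Proof.
  intros (q & Hq & EQ) (r & Hr & ER); exists (fun n => ifz (q n) (r n) 1).
  split; [recs |]; intros n; rewrite EQ, ER.
  destruct (q n); cbn; lia.
Qed.

Lemma dec_not O Q : dec O Q -> dec O (fun n => ~ Q n).
Proof.
  intros (q & Hq & EQ); exists (fun n => ifz (q n) 1 0).
  split; [recs |]; intros n; rewrite EQ.
  destruct (q n); cbn; lia.
Qed.

Lemma dec_or O Q R : dec O Q -> dec O R -> dec O (fun n => Q n \/ R n).
Proof.
  intros HQ HR; apply (dec_ext _ (fun n => ~ (~ Q n /\ ~ R n))).
  - intros n; tauto.
  - auto using dec_not, dec_and.
Qed.

Lemma dec_eq O f g : rec O f -> rec O g -> dec O (fun n => f n = g n).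
Proof.
  intros Hf Hg; apply (dec_ext _ (fun n => ~ (f n < g n) /\ ~ (g n < f n))).
  - intros n; lia.
  - auto using dec_not, dec_and, dec_lt.
Qed.

Lemma dec_all O (Q : nat -> nat -> Prop) b :
  dec O (fun p => Q (p1 p) (p2 p)) -> rec O b ->
  dec O (fun n => forall j, j < b n -> Q n j).
Proof.
  intros (q & Hq & EQ) Hb.
  exists (fun n => natrec 0 (fun j r => ifz r (q (pr n j)) 1) (b n)).
  split; [recs |]; intros n; induction (b n) as [|k IH].
  - cbn; split; [easy | lia].
  - cbn [natrec nat_rect]. fold (natrec 0 (fun j r => ifz r (q (pr n j)) 1) k).
    specialize (EQ (pr n k)); rewrite p1_pr, p2_pr in EQ.
    destruct (natrec 0 _ k) as [|z]; cbn [ifz natrec nat_rect].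
    + rewrite <- EQ; split; [intros H; apply H; lia |].
      intros H j L; destruct (Nat.eq_dec j k) as [-> | D]; [easy |].
      apply IH; [easy | lia].
    + split; [intros H | easy].
      enough (S z = 0) by easy; apply IH; intros; apply H; lia.
Qed.

Definition sig (O : nat -> nat) (Q : nat -> Prop) : Prop :=
  exists D, dec O D /\ forall n, Q n <-> exists w, D (pr n w).

Lemma sig_ext O (Q R : nat -> Prop) : (forall n, Q n <-> R n) -> sig O Q -> sig O R.
Proof.
  intros E (D & HD & H); exists D; split; [easy|]; intros n.
  now rewrite <- E.
Qed.

Lemma sig_dec O Q : dec O Q -> sig O Q.
Proof.
  intros H; exists (fun p => Q (p1 p)); split.
  - apply (dec_sub _ Q); [easy | recs].
  - intros n; split.
    + intros q; exists 0; now rewrite p1_pr.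
    + intros [w q]; now rewrite p1_pr in q.
Qed.

Lemma sig_sub O Q f : sig O Q -> rec O f -> sig O (fun n => Q (f n)).
Proof.
  intros (D & HD & H) Hf; exists (fun p => D (pr (f (p1 p)) (p2 p))); split.
  - apply (dec_sub _ D); [easy | recs].
  - intros n; rewrite H.
    split; intros [w q]; exists w; rewrite ?p1_pr, ?p2_pr in *; easy.
Qed.

Lemma sig_sub2 O (Q : nat -> nat -> Prop) f g :
  sig O (fun p => Q (p1 p) (p2 p)) -> rec O f -> rec O g ->
  sig O (fun n => Q (f n) (g n)).
Proof.
  intros H Hf Hg; generalize (sig_sub _ _ (fun n => pr (f n) (g n)) H).
  intros K; apply (fun E => sig_ext _ _ _ E (K (rec_pr _ _ _ Hf Hg))).
  intros n; cbn beta; now rewrite p1_pr, p2_pr.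
Qed.

Lemma sig_sub3 O (Q : nat -> nat -> nat -> Prop) f g k :
  sig O (fun p => Q (p1 p) (p1 (p2 p)) (p2 (p2 p))) ->
  rec O f -> rec O g -> rec O k -> sig O (fun n => Q (f n) (g n) (k n)).
Proof.
  intros H Hf Hg Hk.
  apply (sig_ext _ (fun n => Q (f n) (p1 (pr (g n) (k n))) (p2 (pr (g n) (k n))))).
  - intros n; now rewrite p1_pr, p2_pr.
  - apply (sig_sub2 _ (fun x y => Q x (p1 y) (p2 y)) f (fun n => pr (g n) (k n)));
      recs; easy.
Qed.

Lemma sig_ex O (Q : nat -> nat -> Prop) :
  sig O (fun p => Q (p1 p) (p2 p)) -> sig O (fun n => exists w, Q n w).
Proof.
  intros (D & HD & H).
  exists (fun p => D (pr (pr (p1 p) (p1 (p2 p))) (p2 (p2 p)))); split.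
  - apply (dec_sub _ D); [easy | recs].
  - intros n; split.
    + intros [w q]; specialize (H (pr n w)); rewrite p1_pr, p2_pr in H.
      apply H in q as [z q]; exists (pr w z).
      now rewrite !p2_pr, !p1_pr.
    + intros [w q]; rewrite p1_pr, p2_pr in q; exists (p1 w).
      specialize (H (pr n (p1 w))); rewrite p1_pr, p2_pr in H; apply H; eauto.
Qed.

Lemma sig_and O Q R : sig O Q -> sig O R -> sig O (fun n => Q n /\ R n).
Proof.
  intros (D & HD & HQ) (E & HE & HR).
  exists (fun p => D (pr (p1 p) (p1 (p2 p))) /\ E (pr (p1 p) (p2 (p2 p)))); split.
  - apply dec_and; [apply (dec_sub _ D) | apply (dec_sub _ E)]; recs; easy.
  - intros n; rewrite HQ, HR; split.
    + intros [[w q] [z r]]; exists (pr w z); rewrite !p2_pr, !p1_pr; auto.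
    + intros [w q]; rewrite !p2_pr, !p1_pr in q; split; eexists; apply q.
Qed.

Lemma sig_or O Q R : sig O Q -> sig O R -> sig O (fun n => Q n \/ R n).
Proof.
  intros (D & HD & HQ) (E & HE & HR).
  exists (fun p => D p \/ E p); split; [now apply dec_or |].
  intros n; rewrite HQ, HR; firstorder.
Qed.

(** Witnesses for the finitely many [j < b n] are packed into one number, which moves the
    existential quantifier to the front. *)
Lemma sig_all O (Q : nat -> nat -> Prop) b :
  sig O (fun p => Q (p1 p) (p2 p)) -> rec O b ->
  sig O (fun n => forall j, j < b n -> Q n j).
Proof.
  intros (D & HD & H) Hb.
  exists (fun p => forall j, j < b (p1 p) -> D (pr (pr (p1 p) j) (nthc (p2 p) j))).
  split.
  - apply (dec_all _ (fun p j => D (pr (pr (p1 p) j) (nthc (p2 p) j)))).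
    + apply (dec_sub _ D); [easy | recs].
    + recs.
  - intros n.
    assert (E : forall j, Q n j <-> exists w, D (pr (pr n j) w)).
    { intros j; rewrite <- H; now rewrite p1_pr, p2_pr. }
    split.
    + intros q; destruct (bounded_choice (fun j w => D (pr (pr n j) w)) (b n))
        as [w Hw].
      { intros j L; apply E; auto. }
      exists (pack w (b n)); rewrite p1_pr, p2_pr; intros j L.
      rewrite nthc_pack; auto.
    + intros [W q] j L; rewrite p1_pr, p2_pr in q; apply E; eauto.
Qed.

Ltac sig_step :=
  match goal with
  | H : sig ?O ?Q |- sig ?O ?Q => exact H
  | |- sig _ (fun n => @?a n /\ @?b n) => apply (sig_and _ a b)
  | |- sig _ (fun n => @?a n \/ @?b n) => apply (sig_or _ a b)
  | |- sig _ (fun n => exists w, @?a n w) => apply (sig_ex _ a)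
  | |- sig _ (fun n => forall j, j < @?b n -> @?a n j) => apply (sig_all _ a b)
  | |- sig _ (fun n => @?a n < @?b n) => apply sig_dec, (dec_lt _ a b)
  | |- sig _ (fun n => @eq nat (@?a n) (@?b n)) => apply sig_dec, (dec_eq _ a b)
  | |- sig _ (fun n => ~ @eq nat (@?a n) (@?b n)) =>
      apply sig_dec, dec_not, (dec_eq _ a b)
  | H : sig _ (fun p => ?Q (p1 p) (p2 p)) |- sig _ (fun n => ?Q (@?a n) (@?b n)) =>
      apply (sig_sub2 _ Q a b H)
  | |- rec _ _ => recs; fail
  end; cbv beta.
Ltac sigs := cbv beta; repeat sig_step; recs.

(** [Mu] searches for the least pair of a value and a witness for it; the first component is
    returned. *)
Lemma sig_selector O (R : nat -> nat -> Prop) :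
  sig O (fun p => R (p1 p) (p2 p)) -> (forall x, exists v, R x v) ->
  exists g, rec O g /\ forall x, R x (g x).
Proof.
  intros (D & (d & [c Hc] & Hd) & H) T.
  assert (E : forall x v, R x v <-> exists w, d (pr (pr x v) w) = 0).
  { intros x v; specialize (H (pr x v)); rewrite p1_pr, p2_pr in H; rewrite H.
    split; intros [w q]; exists w; now apply Hd. }
  assert (M : exists q, rec O q /\ forall x z, q (pr x z) = d (pr (pr x (p1 z)) (p2 z))).
  { exists (fun p => d (pr (pr (p1 p) (p1 (p2 p))) (p2 (p2 p)))); split.
    - assert (rec O d) by (exists c; easy); recs.
    - intros; now rewrite !p2_pr, !p1_pr. }
  destruct M as (q & [cq Hq] & Eq).
  assert (Z : forall x, exists z, q (pr x z) = 0 /\ forall j, j < z -> q (pr x j) <> 0).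
  { intros x; destruct (T x) as [v Hv]; apply E in Hv as [w Hw].
    assert (K : q (pr x (pr v w)) = 0) by now rewrite Eq, p1_pr, p2_pr.
    revert K; generalize (pr v w); intros z; induction z as [z IH] using lt_wf_ind.
    intros K; destruct (classic (exists j, j < z /\ q (pr x j) = 0)) as [(j & L & F) | N].
    - eauto.
    - exists z; split; [easy |]; intros j L F; apply N; eauto. }
  pose (g := fun x => epsilon (inhabits 0)
    (fun z => q (pr x z) = 0 /\ forall j, j < z -> q (pr x j) <> 0)).
  assert (G : forall x, q (pr x (g x)) = 0 /\ forall j, j < g x -> q (pr x j) <> 0).
  { intros x; exact (epsilon_spec (inhabits 0) _ (Z x)). }
  exists (fun x => p1 (g x)); split.
  - apply rec_p1; exists (Mu cq); intros x; destruct (G x) as [G0 G1].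
    apply eval_Mu with (v := fun j => pred (q (pr x j))).
    + intros j L; specialize (G1 j L).
      replace (S (pred (q (pr x j)))) with (q (pr x j)) by lia; apply Hq.
    + rewrite <- G0; apply Hq.
  - intros x; apply E; exists (p2 (g x)); rewrite <- Eq; apply G.
Qed.

(** ** Computations from a partial oracle *)

(** [ev P c n m]: [c] maps [n] to [m], with the oracle given by its graph [P].
    The recursion on [c] makes this a semidecidable predicate when [P] is one. *)
Fixpoint ev (P : nat -> nat -> Prop) (c : code) (n m : nat) : Prop :=
  match c with
  | Zero => m = 0
  | Succ => m = S n
  | Fst => m = p1 n
  | Snd => m = p2 n
  | Oracle => P n m
  | Pair c d => ev P c n (p1 m) /\ ev P d n (p2 m)
  | Comp c d => exists k, ev P d n k /\ ev P c k m
  | Prec c d => exists W, ev P c (p1 n) (nthc W 0) /\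
      (forall j, j < p2 n ->
        ev P d (pr (p1 n) (pr j (nthc W j))) (nthc W (S j))) /\
      nthc W (p2 n) = m
  | Mu c => (forall j, j < m -> exists v, ev P c (pr n j) (S v)) /\
      ev P c (pr n m) 0
  end.

Lemma ev_sound (P : nat -> nat -> Prop) O c :
  (forall n m, P n m -> O n = m) ->
  forall n m, ev P c n m -> eval O c n m.
Proof.
  intros HP; induction c; cbn [ev]; intros n m H.
  - subst; constructor.
  - subst; constructor.
  - subst; apply eval_fst.
  - subst; apply eval_snd.
  - apply HP in H as <-; constructor.
  - rewrite <- (pr_eta m); constructor; firstorder.
  - destruct H as (k & H1 & H2); econstructor; eauto.
  - destruct H as (W & H1 & H2 & <-); rewrite <- (pr_eta n) at 1.
    induction (p2 n) as [|k IH].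
    + constructor; auto.
    + econstructor; [apply IH; intros; apply H2; lia | apply IHc2, H2; lia].
  - destruct H as [H1 H2]; destruct (bounded_choice _ _ H1) as [v Hv].
    apply eval_Mu with (v := v); auto.
Qed.

(** The use principle: a halting computation asks only finitely many queries. As [P] is arbitrary
    above [N], the bounds of subcomputations can simply be added. *)
Lemma ev_complete O c n m :
  eval O c n m ->
  exists N, forall P : nat -> nat -> Prop,
    (forall i, i < N -> P i (O i)) -> ev P c n m.
Proof.
  induction 1; cbn [ev].
  - exists 0; auto.
  - exists 0; auto.
  - exists 0; intros; now rewrite p1_pr.
  - exists 0; intros; now rewrite p2_pr.
  - exists (S n); auto.
  - destruct IHeval1 as [N1 H1], IHeval2 as [N2 H2]; exists (N1 + N2).
    intros P HP; rewrite p1_pr, p2_pr.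
    split; [apply H1 | apply H2]; intros; apply HP; lia.
  - destruct IHeval1 as [N1 H1], IHeval2 as [N2 H2]; exists (N1 + N2).
    intros P HP; exists k.
    split; [apply H1 | apply H2]; intros; apply HP; lia.
  - destruct IHeval as [N H1]; exists N; intros P HP; exists (pr m 0).
    rewrite p1_pr, p2_pr, nthc_0; repeat split; [auto | lia].
  - destruct IHeval1 as [N1 H1], IHeval2 as [N2 H2]; exists (N1 + N2).
    intros P HP; cbn [ev] in H1; destruct (H1 P) as (W & A & B & C).
    { intros; apply HP; lia. }
    specialize (H2 P (fun i L => HP i (Nat.lt_le_trans _ _ _ L (Nat.le_add_l _ _)))).
    rewrite p1_pr, p2_pr in *.
    (* The old [W] is unconstrained past position [k], so [m] is written at position [S k]. *)
    exists (pack (fun j => if Nat.eq_dec j (S k) then m else nthc W j) (S (S k))).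
    rewrite !nthc_pack by lia; repeat split.
    + easy.
    + intros j L; rewrite !nthc_pack by lia.
      destruct (Nat.eq_dec j (S k)); [lia |].
      destruct (Nat.eq_dec (S j) (S k)) as [E | E].
      * injection E as ->; rewrite C; easy.
      * apply B; lia.
    + destruct (Nat.eq_dec (S k) (S k)); easy.
  - assert (M : exists M, forall j, j < k -> forall P : nat -> nat -> Prop,
      (forall i, i < M -> P i (O i)) -> ev P c (pr a j) (S (v j))).
    { clear H H1 IHeval; induction k as [|k IH]; [exists 0; lia |].
      destruct IH as [M1 I1]; [intros; apply H0; lia |].
      destruct (H0 k) as [M2 I2]; [lia |]; exists (M1 + M2); intros j L P HP.
      destruct (Nat.eq_dec j k) as [-> | D].
      - apply I2; intros; apply HP; lia.
      - apply I1; [lia |]; intros; apply HP; lia. }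
    destruct M as [M HM], IHeval as [N HN]; exists (M + N); intros P HP; split.
    + intros j L; exists (v j); apply HM; [easy |]; intros; apply HP; lia.
    + apply HN; intros; apply HP; lia.
Qed.

(** ** Strings *)

(** A number [t] stands for the string of length [p1 t] whose entries, the last
    one first, are listed by [p2 t]. *)
Definition ent (t j : nat) : nat := nthc (p2 t) (p1 t - S j).

Lemma len_child t i : p1 (child t i) = S (p1 t).
Proof. apply p1_pr. Qed.

Lemma ent_child_last t i : ent (child t i) (p1 t) = i.
Proof.
  unfold ent; rewrite len_child, Nat.sub_diag; unfold child; rewrite p2_pr.
  apply nthc_0.
Qed.

Lemma ent_child t i j : j < p1 t -> ent (child t i) j = ent t j.
Proof.
  intros L; unfold ent; rewrite len_child; unfold child; rewrite p2_pr.
  replace (S (p1 t) - S j) with (S (p1 t - S j)) by lia; apply nthc_S.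
Qed.

Inductive ext (t : nat) : nat -> Prop :=
| ext_refl : ext t t
| ext_child u i : ext t u -> ext t (child u i).

Lemma ext_trans t u v : ext t u -> ext u v -> ext t v.
Proof. intros H; induction 1; auto using ext_child. Qed.

Lemma ext_spec t u : ext t u ->
  p1 t <= p1 u /\ forall j, j < p1 t -> ent u j = ent t j.
Proof.
  induction 1 as [|u i H [L IH]]; [auto |].
  rewrite len_child; split; [lia |]; intros j Lj.
  rewrite ent_child by lia; auto.
Qed.

(** The finite part of [join f X] determined by an initial segment [t] of [f]. *)
Definition orc (X : nat -> nat) (t n m : nat) : Prop :=
  (exists i, n = 2 * i /\ i < p1 t /\ m = ent t i) \/
  (exists i, n = S (2 * i) /\ m = X i).

Lemma orc_sound f X t :
  (forall j, j < p1 t -> f j = ent t j) ->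
  forall n m, orc X t n m -> join f X n = m.
Proof.
  intros H n m [(i & -> & L & ->) | (i & -> & ->)]; unfold join.
  - rewrite Nat.even_even, Nat.div2_double; auto.
  - replace (S (2 * i)) with (2 * i + 1) by lia.
    rewrite Nat.even_odd; f_equal.
    replace (2 * i + 1) with (S (2 * i)) by lia; apply Nat.div2_succ_double.
Qed.

Lemma orc_complete f X t :
  (forall j, j < p1 t -> f j = ent t j) ->
  forall n, n < p1 t -> orc X t n (join f X n).
Proof.
  intros H n L; unfold join, orc.
  destruct (Nat.Even_or_Odd n) as [[i ->] | [i ->]].
  - left; exists i; rewrite Nat.even_even, Nat.div2_double.
    repeat split; [lia | apply H; lia].
  - right; exists i; rewrite Nat.even_odd; split; [lia |].
    replace (2 * i + 1) with (S (2 * i)) by lia; f_equal.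
    apply Nat.div2_succ_double.
Qed.

(** For a fixed program, [ev] unfolds by induction on [c] into decidable conditions under
    existential and bounded quantifiers. *)
Lemma sig_ev X c :
  sig X (fun q => ev (orc X (p1 q)) c (p1 (p2 q)) (p2 (p2 q))).
Proof.
  assert (K : forall c,
    sig X (fun q => ev (orc X (p1 q)) c (p1 (p2 q)) (p2 (p2 q))) ->
    forall f g k, rec X f -> rec X g -> rec X k ->
    sig X (fun n => ev (orc X (f n)) c (g n) (k n))).
  { intros d H f g k; exact (sig_sub3 X (fun t => ev (orc X t) d) f g k H). }
  induction c; cbn [ev]; try (unfold orc, ent; sigs; fail); sigs; apply K; auto; recs.
Qed.

(** ** Bushy trees *)

(** [B] is [k]-big above [t] in the usual terminology; the derivation is the bushy tree. *)
Inductive big (k : nat) (B : nat -> Prop) (t : nat) : Prop :=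
| big_leaf : B t -> big k B t
| big_node l : NoDup l -> k <= length l ->
    (forall i, In i l -> big k B (child t i)) -> big k B t.

Lemma big_empty k B t : (forall u, ~ B u) -> ~ big (S k) B t.
Proof.
  intros N; induction 1 as [t H | t [|i l] _ L _ IH]; [firstorder | |].
  - cbn in L; lia.
  - apply (IH i); now left.
Qed.

(** The pigeonhole principle for the children of a node, as [big_union] uses it. *)
Lemma split_NoDup (P Q : nat -> Prop) l : forall a b,
  NoDup l -> a + b <= length l -> (forall i, In i l -> P i \/ Q i) ->
  (exists m, NoDup m /\ a <= length m /\ forall i, In i m -> In i l /\ P i) \/
  (exists m, NoDup m /\ b <= length m /\ forall i, In i m -> In i l /\ Q i).
Proof.
  induction l as [|x l IH]; intros a b ND L H.
  - left; exists nil; cbn in L; repeat split; [constructor | cbn; lia | easy | easy].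
  - apply NoDup_cons_iff in ND as [Nx ND]; cbn in L.
    assert (H' : forall i, In i l -> P i \/ Q i) by (intros; apply H; now right).
    destruct (H x (or_introl eq_refl)) as [Hx | Hx].
    + destruct a as [|a].
      { left; exists nil; repeat split; [constructor | cbn; lia | easy | easy]. }
      destruct (IH a b ND ltac:(lia) H') as [(m & N & Lm & Hm) | (m & N & Lm & Hm)].
      * left; exists (x :: m); repeat split; [| cbn; lia | |].
        -- constructor; [intros F; now apply Nx, Hm | easy].
        -- destruct H0 as [<- | F]; [now left | right; now apply Hm].
        -- destruct H0 as [<- | F]; [easy | now apply Hm].
      * right; exists m; repeat split; [easy | easy | right |]; now apply Hm.
    + destruct b as [|b].
      { right; exists nil; repeat split; [constructor | cbn; lia | easy | easy]. }
      destruct (IH a b ND ltac:(lia) H') as [(m & N & Lm & Hm) | (m & N & Lm & Hm)].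
      * left; exists m; repeat split; [easy | easy | right |]; now apply Hm.
      * right; exists (x :: m); repeat split; [| cbn; lia | |].
        -- constructor; [intros F; now apply Nx, Hm | easy].
        -- destruct H0 as [<- | F]; [now left | right; now apply Hm].
        -- destruct H0 as [<- | F]; [easy | now apply Hm].
Qed.

(** Nodes are labelled from the leaves down by an alternative that holds above them; of [a + b]
    children, [a] carry the first label or [b] the second. *)
Lemma big_union a b A B t :
  big (a + b) (fun u => A u \/ B u) t -> big a A t \/ big b B t.
Proof.
  induction 1 as [t [H | H] | t l ND L _ IH].
  - left; now apply big_leaf.
  - right; now apply big_leaf.
  - destruct (split_NoDup _ _ _ _ _ ND L IH) as [(m & N & Lm & Hm) | (m & N & Lm & Hm)];
      [left | right]; apply big_node with m; auto; apply Hm.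
Qed.

Lemma big_mono k A B t : (forall u, A u -> B u) -> big k A t -> big k B t.
Proof.
  intros AB; induction 1; [now apply big_leaf, AB | now apply big_node with l].
Qed.

(** [big_union] splits off one [A v] of width [k] at a time. The successor handles [b = 0]: the
    empty set is 0-big, through a node without children, but not 1-big. *)
Lemma big_bounded_union k (A : nat -> nat -> Prop) b t :
  big (S (b * k)) (fun u => exists v, v < b /\ A v u) t ->
  exists v, v < b /\ big k (A v) t.
Proof.
  induction b as [|b IH]; intros H.
  - exfalso; revert H; apply big_empty; intros u (v & L & _); lia.
  - assert (K : big (S (b * k) + k) (fun u => (exists v, v < b /\ A v u) \/ A b u) t).
    { replace (S (b * k) + k) with (S (S b * k)) by lia.
      revert H; apply big_mono; intros u (v & L & Hv).
      destruct (Nat.eq_dec v b) as [-> | D]; [now right |].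
      left; exists v; split; [lia | easy]. }
    apply big_union in K as [K | K].
    + destruct (IH K) as (v & L & Hv); exists v; split; [lia | easy].
    + exists b; split; [lia | easy].
Qed.

(** Climb the tree for [A], always to a child above which [B] is not big; one exists, since
    otherwise the trees for [B] above the children would join into one above their parent. *)
Lemma big_concat k A B t :
  big k A t -> ~ big k B t -> exists u, ext t u /\ A u /\ ~ big k B u.
Proof.
  induction 1 as [t H | t l ND L _ IH]; intros S.
  - exists t; repeat split; [constructor | easy | easy].
  - destruct (classic (forall i, In i l -> big k B (child t i))) as [F | F].
    + exfalso; apply S; now apply big_node with l.
    + apply not_all_ex_not in F as [i F]; apply imply_to_and in F as [Hi F].
      destruct (IH i Hi F) as (u & E & Hu); exists u; split; [| easy].
      eapply ext_trans; [| exact E]; repeat constructor.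
Qed.

Lemma small_child k B t : ~ big k B t -> exists i, ~ big k B (child t i).
Proof.
  intros H; apply not_all_ex_not; intros F; apply H.
  apply big_node with (seq 0 k); auto using seq_NoDup.
  now rewrite length_seq.
Qed.

(** The strings listed by [s] below [N] are each in [B] or have [k] children
    listed before them, so that [s] presents finite bushy trees. *)
Definition just (k : nat) (B : nat -> Prop) (s : nat -> nat) (N : nat) : Prop :=
  forall j, j < N -> B (s j) \/ exists W,
    (forall i, i < k -> forall i', i' < i -> nthc W i <> nthc W i') /\
    (forall i, i < k -> exists j', j' < j /\ s j' = child (s j) (nthc W i)).

Lemma just_sound k B s N : just k B s N -> forall j, j < N -> big k B (s j).
Proof.
  intros J j; induction j as [j IH] using lt_wf_ind; intros L.
  destruct (J j L) as [H | (W & D & C)]; [now apply big_leaf |].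
  apply big_node with (map (nthc W) (seq 0 k)).
  - assert (E : forall i i', i < k -> i' < k -> nthc W i = nthc W i' -> i = i').
    { intros i i' Li Li' E; destruct (Nat.lt_trichotomy i i') as [F | [F | F]]; auto.
      - now destruct (D i' Li' i F).
      - now destruct (D i Li i' F). }
    apply NoDup_map_NoDup_ForallPairs; [| apply seq_NoDup].
    intros i i' Hi Hi'; apply in_seq in Hi, Hi'; apply E; lia.
  - now rewrite length_map, length_seq.
  - intros i Hi; apply in_map_iff in Hi as (x & <- & Hx); apply in_seq in Hx.
    destruct (C x) as (j' & Lj & E); [lia |]; rewrite <- E; apply IH; lia.
Qed.

Lemma just_app k B s s' N N' : just k B s N -> just k B s' N' ->
  just k B (fun j => if lt_dec j N then s j else s' (j - N)) (N + N').
Proof.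
  intros J J' j L; destruct (lt_dec j N) as [Lj | Lj].
  - destruct (J j Lj) as [H | (W & D & C)]; [now left |]; right; exists W.
    split; [easy |]; intros i Li; destruct (C i Li) as (j' & L' & E).
    exists j'; split; [easy |]; destruct (lt_dec j' N); [easy | lia].
  - destruct (J' (j - N) ltac:(lia)) as [H | (W & D & C)]; [now left |].
    right; exists W; split; [easy |]; intros i Li.
    destruct (C i Li) as (j' & L' & E); exists (j' + N); split; [lia |].
    destruct (lt_dec (j' + N) N); [lia |]; now rewrite Nat.add_sub.
Qed.

(** The lists for the subtrees are concatenated and the root is put last, so that children precede
    their parent. *)
Lemma just_complete k B t : big k B t ->
  exists s N, just k B s N /\ exists j, j < N /\ s j = t.
Proof.
  induction 1 as [t H | t l ND L _ IH].
  - exists (fun _ => t), 1; split; [intros j _; now left | exists 0; auto].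
  - assert (K : exists s N, just k B s N /\
      forall i, In i l -> exists j, j < N /\ s j = child t i).
    { clear ND L; induction l as [|x l IHl].
      - exists (fun _ => 0), 0; split; [intros j Lj; lia | easy].
      - destruct IHl as (s & N & J & C); [intros; apply IH; now right |].
        destruct (IH x) as (s' & N' & J' & j & Lj & E); [now left |].
        eexists _, _; split; [exact (just_app _ _ _ _ _ _ J J') |].
        intros i [<- | Hi].
        + exists (j + N); split; [lia |]; destruct (lt_dec (j + N) N); [lia |].
          now rewrite Nat.add_sub.
        + destruct (C i Hi) as (j' & L' & E'); exists j'; split; [lia |].
          now destruct (lt_dec j' N). }
    destruct K as (s & N & J & C).
    exists (fun j => if lt_dec j N then s j else t), (S N); split.
    + intros j Lj; destruct (lt_dec j N) as [L' | L'].
      * destruct (J j L') as [H | (W & D & C')]; [now left |]; right; exists W.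
        split; [easy |]; intros i Li; destruct (C' i Li) as (j' & L'' & E).
        exists j'; split; [easy |]; destruct (lt_dec j' N); [easy | lia].
      (* The first [k] members of [l] serve as children; [l] has at least [k], so the default 0 is
         never returned. *)
      * right; exists (pack (fun i => nth i l 0) k); split.
        -- intros i Li i' Li'; rewrite !nthc_pack by lia; intros E.
           apply (proj1 (NoDup_nth l 0) ND) in E; lia.
        -- intros i Li; rewrite nthc_pack by lia.
           destruct (C (nth i l 0)) as (j' & L'' & E); [apply nth_In; lia |].
           exists j'; split; [lia |]; now destruct (lt_dec j' N).
    + exists N; split; [lia |]; destruct (lt_dec N N); [lia | easy].
Qed.

Lemma big_iff k B t :
  big k B t <-> exists D N, just k B (nthc D) N /\ exists j, j < N /\ nthc D j = t.
Proof.
  split.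
  - intros H; apply just_complete in H as (s & N & J & j & L & E).
    exists (pack s N), N; split; [| exists j; now rewrite nthc_pack].
    intros i Li; rewrite nthc_pack by easy.
    destruct (J i Li) as [H | (W & Dd & C)]; [now left |]; right; exists W.
    split; [easy |]; intros x Lx; destruct (C x Lx) as (j' & L' & E').
    exists j'; now rewrite nthc_pack by lia.
  - intros (D & N & J & j & L & <-); now apply (just_sound k B (nthc D) N).
Qed.

(** By [big_iff] the quantifier over trees becomes one over numbers, and [just] is semidecidable
    when [B] is. *)
Lemma sig_big O k (B : nat -> nat -> Prop) t :
  sig O (fun p => B (p1 p) (p2 p)) -> sig O (fun q => big k (B q) t).
Proof.
  intros H; apply (sig_ext _ (fun q => exists D N,
    just k (B q) (nthc D) N /\ exists j, j < N /\ nthc D j = t)).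
  - intros q; symmetry; apply big_iff.
  - unfold just; sigs.
Qed.

(** ** Forcing *)

Definition notDNC (X : nat -> nat) (t : nat) : Prop :=
  exists e, e < p1 t /\ phi X e e (ent t e).

Lemma phi_det O e n m m' : phi O e n m -> phi O e n m' -> m = m'.
Proof.
  intros (c & E & H) (c' & E' & H'); rewrite <- E' in E; apply goedel_inj in E as ->.
  eapply eval_det; eauto.
Qed.

(** [phi X] has at most one value at index and argument [p1 t], so of two distinct children one
    fails to be DNC only because [t] already does. *)
Lemma notDNC_small X t : big 2 (notDNC X) t -> notDNC X t.
Proof.
  induction 1 as [t H | t l ND L _ IH]; [easy |].
  destruct l as [|i [|i' l]]; cbn in L; try lia.
  assert (C : forall x, notDNC X (child t x) -> ~ notDNC X t -> phi X (p1 t) (p1 t) x).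
  { intros x (e & Le & He) N; rewrite len_child in Le.
    destruct (Nat.eq_dec e (p1 t)) as [-> | D].
    - now rewrite ent_child_last in He.
    - rewrite ent_child in He by lia; exfalso; apply N; exists e; split; [lia | easy]. }
  apply NNPP; intros N; apply NoDup_cons_iff in ND as [ND _]; apply ND; left.
  eapply phi_det; apply C; try apply IH; cbn; auto.
Qed.

Lemma computes_rec O g : computes O g <-> rec O g.
Proof.
  split.
  - intros [e H]; destruct (H 0) as (c & E & _); exists c; intros n.
    destruct (H n) as (c' & E' & H'); rewrite <- E in E'.
    now apply goedel_inj in E' as <-.
  - intros [c H]; exists (goedel c); intros n; now exists c.
Qed.

Fixpoint no_oracle (c : code) : code :=
  match c with
  | Oracle => Zero
  | Pair c d => Pair (no_oracle c) (no_oracle d)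
  | Comp c d => Comp (no_oracle c) (no_oracle d)
  | Prec c d => Prec (no_oracle c) (no_oracle d)
  | Mu c => Mu (no_oracle c)
  | c => c
  end.

(** The empty oracle answers every query with 0, so [Zero] can replace [Oracle], and the result runs
    alike with any oracle. *)
Lemma computable_rec O g : computable g -> rec O g.
Proof.
  intros H; apply computes_rec in H as [c H]; exists (no_oracle c).
  intros n; generalize (H n); generalize (g n); clear; intros m.
  induction 1; cbn [no_oracle]; econstructor; eauto.
Qed.

(** A function [f] meets the condition when it extends [stem] and has no initial
    segment in [bad]; smallness lets every stem be prolonged. *)
Record cond (X : nat -> nat) : Type := Cond {
  stem : nat;
  width : nat;
  bad : nat -> Prop;
  bad_small : ~ big width bad stem;
  bad_notDNC : forall u, notDNC X u -> bad u
}.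
Arguments stem {X}. Arguments width {X}. Arguments bad {X}.

Definition below {X} (p q : cond X) : Prop :=
  ext (stem q) (stem p) /\ forall u, bad q u -> bad p u.

(** Two ways to keep [c] from computing a function in DNC_h: it agrees with the diagonal at some
    [e], or at some [x] it has no value below [h x]. *)
Definition forces X h c (p : cond X) : Prop :=
  (exists e m, phi0 e e m /\ ev (orc X (stem p)) c e m) \/
  (exists x, forall u, (exists v, v < h x /\ ev (orc X u) c x v) -> bad p u).

Lemma force_code X h c (p : cond X) :
  rec X h -> (forall g, rec X g -> ~ DNC_below h g) ->
  exists q, below q p /\ forces X h c q.
Proof.
  intros Hh HX.
  destruct (classic (exists x M,
    ~ big M (fun u => exists v, v < h x /\ ev (orc X u) c x v) (stem p)))
    as [(x & M & S) | N].
  - pose (A u := exists v, v < h x /\ ev (orc X u) c x v).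
    (* By [big_union], avoiding two small sets at once costs the sum of their widths. *)
    assert (S' : ~ big (M + width p) (fun u => A u \/ bad p u) (stem p)).
    { intros H; destruct (big_union _ _ _ _ _ H) as [K | K];
        [exact (S K) | exact (bad_small X p K)]. }
    exists (Cond X _ _ _ S' (fun u H => or_intror (bad_notDNC X p u H))).
    split; [split; [constructor | now right] |].
    right; exists x; now left.
  - assert (T : forall x, exists v, v < h x /\
      big (width p) (fun u => ev (orc X u) c x v) (stem p)).
    (* The [M] used here is [S (h x * width p)]. *)
    { intros x; apply big_bounded_union, NNPP; intros F; apply N; eauto. }
    apply (sig_selector X) in T as (g & Hg & Eg).
    + assert (D : exists e, phi0 e e (g e)).
      { apply NNPP; intros F; apply (HX g Hg); split; [| apply Eg].
        intros e m H E; apply F; exists e; now rewrite E. }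
      destruct D as [e He].
      destruct (big_concat _ _ _ _ (proj2 (Eg e)) (bad_small X p)) as (u & E & A & S).
      exists (Cond X u (width p) (bad p) S (bad_notDNC X p)).
      split; [now split |]; left; exists e, (g e); auto.
    + apply sig_and; [sigs |].
      apply (sig_big _ _ (fun q u => ev (orc X u) c (p1 q) (p2 q))).
      apply (sig_sub3 X (fun t => ev (orc X t) c)); [apply sig_ev | recs ..].
Qed.

Lemma below_trans X (p q r : cond X) : below p q -> below q r -> below p r.
Proof. intros [E B] [E' B']; split; [eapply ext_trans; eauto | auto]. Qed.

(** The stem first grows by one entry, so that the stems have a total function as limit. If [s] is
    no Goedel number, this is all. *)
Lemma force_step X h s (p : cond X) :
  rec X h -> (forall g, rec X g -> ~ DNC_below h g) ->
  exists q, below q p /\ p1 (stem p) < p1 (stem q) /\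
    forall c, goedel c = s -> forces X h c q.
Proof.
  intros Hh HX; destruct (small_child _ _ _ (bad_small X p)) as [i S].
  pose (p' := Cond X _ _ _ S (bad_notDNC X p)).
  assert (E : below p' p) by (split; [repeat constructor | auto]).
  assert (L : p1 (stem p) < p1 (stem p')) by (cbn; rewrite len_child; lia).
  destruct (classic (exists c, goedel c = s)) as [[c Hc] | N].
  - destruct (force_code X h c p' Hh HX) as (q & Hq & F).
    exists q; split; [eapply below_trans; eauto | split].
    + apply (Nat.lt_le_trans _ _ _ L), ext_spec, Hq.
    + intros c' Hc'; rewrite <- Hc in Hc'; now apply goedel_inj in Hc' as ->.
  - exists p'; repeat split; try apply E; [easy |].
    intros c Hc; exfalso; eauto.
Qed.

(** * The generic function *)

Theorem theorem3p4 (h : nat -> nat) (X : nat -> Prop)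
  (h_order : order_function h)
  (X_weak : ~ exists g, DNC_below h g /\ computes (char X) g) :
  exists f : nat -> nat,
    DNC_rel X f /\
    ~ exists g, DNC_below h g /\ computes (join f (char X)) g.
Proof.
  pose proof (computable_rec (char X) h (proj1 h_order)) as Hh.
  assert (HX : forall g, rec (char X) g -> ~ DNC_below h g).
  { intros g Hg D; apply X_weak; exists g; split; [easy | now apply computes_rec]. }
  assert (S0 : ~ big 2 (notDNC (char X)) (pr 0 0)).
  { intros H; apply notDNC_small in H as (e & L & _); rewrite p1_pr in L; lia. }
  pose (step := fun s (p : cond (char X)) => constructive_indefinite_description _
    (force_step (char X) h s p Hh HX)).
  (* Start from the empty string, avoiding [notDNC] with width 2; stage [s] treats the program with
     Goedel number [s]. *)
  pose (P := nat_rect (fun _ => cond (char X))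
    (Cond _ _ _ _ S0 (fun _ H => H)) (fun s p => proj1_sig (step s p))).
  assert (PS : forall s, below (P (S s)) (P s) /\
    p1 (stem (P s)) < p1 (stem (P (S s))) /\
    forall c, goedel c = s -> forces (char X) h c (P (S s))).
  { intros s; exact (proj2_sig (step s (P s))). }
  assert (mono : forall s d, below (P (d + s)) (P s)).
  { intros s d; induction d as [|d IH]; [split; [constructor | auto] |].
    eapply below_trans; [apply PS | exact IH]. }
  assert (len : forall s, s <= p1 (stem (P s))).
  { intros s; induction s as [|s IH]; [lia |]; destruct (PS s) as (_ & L & _); lia. }
  clearbody P; clear step.
  (* By [len], the stem at stage [S j] is long enough to have an entry [j]. *)
  pose (f := fun j => ent (stem (P (S j))) j).
  assert (Hf : forall s j, j < p1 (stem (P s)) -> f j = ent (stem (P s)) j).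
  { intros s j L; unfold f.
    (* The stem at stage [S j + s] extends both stems to be compared. *)
    destruct (ext_spec _ _ (proj1 (mono s (S j)))) as [_ E1].
    destruct (ext_spec _ _ (proj1 (mono (S j) s))) as [_ E2].
    specialize (len (S j)); rewrite <- E1, <- E2 by lia; f_equal; f_equal; f_equal; lia. }
  clearbody f; exists f; split.
  (* Otherwise the stem at stage [S e], which has an entry [e], would lie in its own bad set and be
     a one-leaf tree for it. *)
  - intros e m H E; apply (bad_small _ (P (S e))), big_leaf, bad_notDNC.
    specialize (len (S e)); exists e; split; [lia |].
    rewrite <- (Hf (S e)), E by lia; exact H.
  - intros (g & [D Dh] & Hg); apply computes_rec in Hg as [c Hc].
    destruct (PS (goedel c)) as (_ & _ & F); specialize (F c eq_refl).
    set (q := P (S (goedel c))) in F; destruct F as [(e & m & Hm & He) | [x Hx]].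
    + apply (D e m Hm).
      eapply eval_det; [apply Hc |].
      revert He; apply ev_sound, orc_sound, Hf.
    (* A stem of length at least [N] already yields the value [g x], which is below [h x]; hence
       that stem is bad, again impossible. *)
    + destruct (ev_complete _ _ _ _ (Hc x)) as [N HN].
      apply (bad_small _ (P (N + S (goedel c)))), big_leaf.
      apply mono, Hx; exists (g x); split; [apply Dh |].
      apply HN; intros i Li; apply orc_complete; [apply Hf |].
      specialize (len (N + S (goedel c))); lia.
Qed.
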